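(* Let $P$ be a well-formed closed polyomino with no appendages such that the number of squares between each pair of consecutive HV-squares is odd. Then $P$ can be folded from one level to two levels.
   Context: A polyomino is a plane figure formed by joining one or more unit squares edge-to-edge; its genus is the number of holes. An HV-square is a square of the polyomino attached to at least one other square along a vertical edge and to at least one other square along a horizontal edge. A polyomino is well-formed if no two HV-squares are adjacent. A chain is a straight strip of squares containing no HV-square. A closed polyomino with no appendages is a polyomino of genus $g>0$ formed of closed loops of squares, with no chain of squares that is attached to an HV-square at one end and free at the other end. Two HV-squares are consecutive if they are joined by a straight chain of squares of the polyomino with no other HV-square between them; the number of squares between them is the number of squares of this joining chain (the two HV-squares themselves not counted). A paper cutout of the polyomino $P$ is folded from one level to two levels if, after folding and cutting as allowed, the resulting figure has the same shape as $P$ (is similar to $P$; by area the scale factor is $1/\sqrt2$) and has exactly two layers of paper over its entire area; where a cut was made, the cut ends must come back together. Allowed moves: a corner fold, which folds a corner of a square inward along the crease joining the midpoints of two consecutive sides of that square; a corner fold may be extended across an edge to a second adjacent square (the straight crease continues into the adjacent square, again joining midpoints of two consecutive sides there). A half edge cut is a cut halfway along one edge between two adjacent squares. For a closed polyomino of genus $g>0$ one is additionally allowed to cut completely along $g$ edges between adjacent squares (one cut for each hole, connecting the holes to the outside). *)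

(* Defs.v *)
From mathcomp Require Import all_boot all_order all_algebra finmap reals.
Set Implicit Arguments.
Unset Strict Implicit.
Unset Printing Implicit Defensive.
Import Order.TTheory GRing.Theory Num.Theory.
Local Open Scope ring_scope.

(** * Polyominoes *)

(* The cell (i, j) stands for the unit square [i, i+1] x [j, j+1]. *)
Definition cell : Type := (int * int)%type.

Definition hdirs : seq cell := [:: (1, 0); (-1, 0)].
Definition vdirs : seq cell := [:: (0, 1); (0, -1)].
Definition dirs : seq cell := hdirs ++ vdirs.

Definition adj : rel cell := fun x y => y - x \in dirs.

Definition linked (r : rel cell) (A : pred cell) (x y : cell) : Prop :=
  exists p : seq cell, [/\ path r x p, last x p = y & all A (x :: p)].

Definition is_polyomino (P : {fset cell}) : Prop :=
  P != fset0 /\ {in P &, forall x y, linked adj (mem P) x y}.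

Definition in_hole (P : {fset cell}) (x : cell) : Prop :=
  x \notin P /\
  exists N : int, forall y, linked adj (predC (mem P)) x y ->
    (`|y.1| <= N) && (`|y.2| <= N).

(* [s] lists one cell out of each hole.  Complementary squares that touch only
   at a corner are separated there by P, so edge-adjacency gives the components
   of the complement of the (closed) plane figure. *)
Definition has_genus (P : {fset cell}) (g : nat) : Prop :=
  exists s : seq cell,
    [/\ size s = g,
        {in s, forall x, in_hole P x},
        forall i j : nat, (i < j < g)%N ->
          ~ linked adj (predC (mem P)) (nth 0 s i) (nth 0 s j) &
        forall x, in_hole P x ->
          exists2 y, y \in s & linked adj (predC (mem P)) y x].

(* Squares side by side (difference in [hdirs]) share a vertical edge. *)
Definition HV (P : {fset cell}) (x : cell) : bool :=
  [&& x \in P, has (fun d => x + d \in P) hdirs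
    & has (fun d => x + d \in P) vdirs].

Definition well_formed (P : {fset cell}) : Prop :=
  forall x y, HV P x -> HV P y -> ~~ adj x y.

(* The strip of n squares x, x + d, ..., x + (n-1) d. *)
Definition chain (P : {fset cell}) (x d : cell) (n : nat) : Prop :=
  forall k, (k < n)%N -> (x + d *+ k \in P) && ~~ HV P (x + d *+ k).

Definition consecutive_HV (P : {fset cell}) (x d : cell) (n : nat) : Prop :=
  [/\ d \in dirs, HV P x, chain P (x + d) d n & HV P (x + d *+ n.+1)].

Definition odd_spacing (P : {fset cell}) : Prop :=
  forall x d n, consecutive_HV P x d n -> odd n.

(* The far end of the chain is free: its last square is not an HV-square, so
   the only other square that could be attached to it is x + (n+1) d. *)
Definition appendage (P : {fset cell}) (x d : cell) (n : nat) : Prop :=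
  [/\ d \in dirs, HV P x, (0 < n)%N, chain P (x + d) d n
    & x + d *+ n.+1 \notin P].

Definition no_appendages (P : {fset cell}) : Prop :=
  forall x d n, ~ appendage P x d n.

(* A closed loop returns to its start and never turns straight back.  Squares
   may be repeated, so that a chain joining two cycles lies on a loop too. *)
Definition closed_loop (P : {fset cell}) (s : seq cell) : Prop :=
  [/\ cycle adj s, {subset s <= P} &
      forall i : nat, (i < size s)%N ->
        nth 0 s i != nth 0 s (i.+2 %% size s)%N].

Definition closed_polyomino (P : {fset cell}) (g : nat) : Prop :=
  [/\ has_genus P g, (0 < g)%N &
      {in P, forall x, exists2 s, closed_loop P s & x \in s}].

(** * The paper *)

(* (x, false) is the vertical edge between x and x + (1, 0), and
   (x, true) is the horizontal edge between x and x + (0, 1). *)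
Definition edge : Type := (cell * bool)%type.

Definition far (e : edge) : cell := e.1 + (if e.2 then (0, 1) else (1, 0)).

Definition edges (P : {fset cell}) : seq edge :=
  [seq e <- [seq (x, v) | x <- P, v <- [:: false; true]] | far e \in P].

(* (a, b) is the corner at offset (a, b) from the lower left one. *)
Definition corner : Type := (bool * bool)%type.

(* The creases joining midpoints of consecutive sides divide a square x into
   the central diamond (x, None) and the corner triangles (x, Some c). *)
Definition piece : Type := (cell * option corner)%type.

(* Half [t] of an edge is its upper (right) half if t = true, else its lower
   (left) half.  It is a side of one corner triangle in each of the two
   squares. *)
Definition near_corner (v t : bool) : corner :=
  if v then (t, true) else (true, t).
Definition far_corner (v t : bool) : corner :=
  if v then (t, false) else (false, t).

Section Plane.
Variable R : realType.
Implicit Types (x : cell) (c : corner) (z w : R * R).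

Definition edist z w : R := Num.sqrt ((z.1 - w.1) ^+ 2 + (z.2 - w.2) ^+ 2).

Definition isometry (f : R * R -> R * R) : Prop :=
  forall z w, edist (f z) (f w) = edist z w.

Definition similarity (k : R) (f : R * R -> R * R) : Prop :=
  forall z w, edist (f z) (f w) = k * edist z w.

Definition center x : R * R := (x.1%:~R + 2^-1, x.2%:~R + 2^-1).
Definition corner_pt x c : R * R :=
  (x.1%:~R + (nat_of_bool c.1)%:R, x.2%:~R + (nat_of_bool c.2)%:R).
Definition edge_midpoint (e : edge) : R * R :=
  let z := center e.1 in if e.2 then (z.1, z.2 + 2^-1) else (z.1 + 2^-1, z.2).

Definition unit_square x z : Prop :=
  x.1%:~R <= z.1 <= x.1%:~R + 1 /\ x.2%:~R <= z.2 <= x.2%:~R + 1.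
Definition open_unit_square x z : Prop :=
  x.1%:~R < z.1 < x.1%:~R + 1 /\ x.2%:~R < z.2 < x.2%:~R + 1.

Definition plane_figure (P : {fset cell}) z : Prop :=
  exists2 x, x \in P & unit_square x z.

Definition dist1 z w : R := `|z.1 - w.1| + `|z.2 - w.2|.

Definition piece_region (p : piece) z : Prop :=
  match p.2 with
  | None => dist1 z (center p.1) <= 2^-1
  | Some c => unit_square p.1 z /\ dist1 z (corner_pt p.1 c) <= 2^-1
  end.

Definition piece_interior (p : piece) z : Prop :=
  match p.2 with
  | None => dist1 z (center p.1) < 2^-1
  | Some c => open_unit_square p.1 z /\ dist1 z (corner_pt p.1 c) < 2^-1
  end.

(* The reflection in the crease at corner c, which is the line
   (z - center x) . u = 1/2, where u = (+-1, +-1) points towards c. *)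
Definition crease_reflection x c z : R * R :=
  let u : R * R := ((-1) ^+ ~~ c.1, (-1) ^+ ~~ c.2) in
  let t := (z.1 - (center x).1) * u.1 + (z.2 - (center x).2) * u.2 - 2^-1 in
  (z.1 - t * u.1, z.2 - t * u.2).

(** * Flat folded states *)

Record folding := Folding {
  cut : edge -> bool -> bool;        (* is this half of the edge cut? *)
  crease : cell -> corner -> bool;   (* is this corner folded? *)
  place : piece -> R * R -> R * R;   (* where each piece of paper goes *)
  level : piece -> bool              (* true: upper level; false: lower level *)
}.

Implicit Types (P : {fset cell}) (f : folding) (p : piece).

Definition fully_cut f (e : edge) : bool := cut f e false && cut f e true.

Definition attached f : rel cell := fun x y =>
  has (fun v => (y == far (x, v)) && ~~ fully_cut f (x, v)
             || (x == far (y, v)) && ~~ fully_cut f (y, v)) [:: false; true].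

(* Half edge cuts are free; at most g edges are cut completely, and they leave
   the paper in one piece, i.e. each such cut joins a hole to the outside or to
   another hole. *)
Definition admissible_cuts P (g : nat) f : Prop :=
  (count (fully_cut f) (edges P) <= g)%N /\
  {in P &, forall x y, linked (attached f) (mem P) x y}.

Definition opposite c : corner := (~~ c.1, ~~ c.2).

(* The crease line at corner c of x runs on into y, across their common edge. *)
Definition extends_to P f x c y : bool :=
  [&& y \in P, attached f x y & crease f y (opposite c)].

(* A corner fold extends to at most one further square. *)
Definition admissible_creases P f : Prop :=
  forall x c, x \in P -> crease f x c ->
    ~~ (extends_to P f x c (x + ((-1) ^+ ~~ c.1, 0)) &&
        extends_to P f x c (x + (0, (-1) ^+ ~~ c.2))).

Definition corners_folded P f : Prop :=
  forall x c, x \in P ->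
    if crease f x c
    then place f (x, Some c) =1 place f (x, None) \o crease_reflection x c
    else place f (x, Some c) =1 place f (x, None) /\
         level f (x, Some c) = level f (x, None).

Definition uncut_edges_flat P f : Prop :=
  forall e t, e \in edges P -> ~~ cut f e t ->
    let p := (e.1, Some (near_corner e.2 t)) in
    let q := (far e, Some (far_corner e.2 t)) in
    place f p =1 place f q /\ level f p = level f q.

Definition folded_figure P f w : Prop :=
  exists p z, [/\ p.1 \in P, piece_region p z & w = place f p z].

Definition on_level P f (b : bool) p : Prop := p.1 \in P /\ level f p = b.

(* Each level covers the whole folded figure once: all of it is covered, and
   distinct pieces on a level overlap at most along their boundaries. *)
Definition two_layers P f : Prop :=
  forall b : bool,
    (forall w, folded_figure P f w ->
       exists p z, [/\ on_level P f b p, piece_region p z & w = place f p z]) /\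
    (forall p q z z', on_level P f b p -> on_level P f b q ->
       piece_interior p z -> piece_interior q z' ->
       place f p z = place f q z' -> p = q).

Definition same_shape P f : Prop :=
  exists2 s, similarity (Num.sqrt 2)^-1 s &
    forall w, folded_figure P f w <-> exists2 z, plane_figure P z & w = s z.

(* The two squares separated by a (half or complete) cut become neighbours
   again: their diamonds, of side 1/sqrt 2, have a common vertex at the image
   of the midpoint of the edge, and centers 1/sqrt 2 apart, hence they have a
   common side. *)
Definition cut_ends_meet P f : Prop :=
  forall e, e \in edges P -> cut f e false || cut f e true ->
    place f (e.1, None) (edge_midpoint e) =
      place f (far e, None) (edge_midpoint e) /\
    edist (place f (e.1, None) (center e.1))
          (place f (far e, None) (center (far e))) = (Num.sqrt 2)^-1.

Definition folds_to_two_levels P (g : nat) : Prop :=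
  exists f : folding,
    [/\ (forall p, p.1 \in P -> isometry (place f p)),
        admissible_cuts P g f /\ admissible_creases P f,
        corners_folded P f /\ uncut_edges_flat P f,
        two_layers P f &
        same_shape P f /\ cut_ends_meet P f].

End Plane.

(* Main.v *)
Require Import Defs.
From mathcomp Require Import all_boot all_order all_algebra finmap reals.
From mathcomp Require Import zify lra ring.

(** Since P is connected, every cell can be reached from a given HV-square
    through chains.  A chain leaving an HV-square ends at another one
    ([consecutive_from]: there are no appendages), an even number of steps
    away.  So all HV-squares have the same coordinates modulo 2 as one of them,
    h, and every other cell lies straight between two of them.  Hence P is
    aligned with h ([exists_aligned]): two cells side by side lie in a row of
    even offset from h, and one of them is in a column of even offset; likewise
    with rows and columns exchanged.  Cells thus come in three kinds: nodes
    (both offsets even), horizontal links (odd column) and vertical links (odd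
    row).

    Let [shrink] turn the plane by -45 degrees and scale it by 1/sqrt 2.  It
    maps the unit square of x to a diamond as large as the central diamond of
    x.  The folding moves this central diamond onto its shrunk square: the
    paper of a node is translated, that of a horizontal link is also reflected
    in an antidiagonal, and that of a vertical link in a diagonal.  Nodes lie on
    the lower level, links on the upper one.  This is what repeated accordion
    folds along a chain do: neighbours differ by the reflection in one crease
    line, which is extended across their common edge ([lay_far]).

    The four sides of the diamond of x correspond both to the corners of x and,
    after shrinking, to its neighbours; [dir] is this correspondence.  Corner c
    is folded exactly when there is no cell at x + dir c.  A folded corner
    covers the quarter of its own diamond next to it.  An unfolded corner covers
    the quarter of the neighbouring diamond across their common side, and the
    neighbour, whose corner there is unfolded too, returns the favour.  So each
    diamond is covered once by its own centre, on one level, and once by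
    exactly four triangles, on the other ([slot_region_closed],
    [slot_region_open], [slotK], [level_slot]), which gives two layers.

    The crease line through an edge cuts off one corner of each of its two
    cells, and these corners touch different halves of the edge.  Such a half
    can stay uncut exactly when that corner is folded.  If both corners were
    unfolded, both cells would also have neighbours in the perpendicular
    direction, and both would be nodes, which no two adjacent cells are
    ([grid_not_fully_cut]).  So every edge stays attached along at least one
    half, and half edge cuts suffice. *)

Set Implicit Arguments.
Unset Strict Implicit.
Unset Printing Implicit Defensive.
Import Order.TTheory GRing.Theory Num.Theory.
Local Open Scope ring_scope.

(** * HV-squares agree modulo two *)

Implicit Types (P : {fset cell}) (h x y d : cell).

Lemma HV_in P x : HV P x -> x \in P.
Proof. by case/and3P. Qed.

Lemma chain_stops P x d : d \in dirs -> exists n, x + d *+ n \notin P.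
Proof.
move=> dD.
have [N NP] : exists N : nat, {in P, forall y, (absz y.1 + absz y.2 < N)%N}.
  exists (\max_(y <- P) (absz y.1 + absz y.2)).+1 => y yP.
  rewrite ltnS.
  by apply: (leq_bigmax_seq (F := fun y : cell => (absz y.1 + absz y.2)%N) y).
exists (N + absz x.1 + absz x.2)%N; apply/negP => /NP /=.
rewrite !(raddfMn fst) !(raddfMn snd).
move: dD; rewrite !inE => /or4P[] /eqP -> /=; rewrite ?mul0rn; lia.
Qed.

(** The maximal chain from x in direction d is bounded since P is finite; were
    its end not followed by an HV-square, the chain would be an appendage. *)
Lemma consecutive_from P x d : no_appendages P -> d \in dirs -> HV P x ->
  x + d \in P -> exists n, consecutive_HV P x d n.
Proof.
move=> noapp dD HVx xdP.
pose stop n := ~~ ((x + d *+ n.+1 \in P) && ~~ HV P (x + d *+ n.+1)).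
have [n stopn minn] : exists2 n, stop n & forall k, (k < n)%N -> ~~ stop k.
  have ex : exists n, stop n.
    have [n nP] := chain_stops P (x + d) dD.
    by exists n; rewrite /stop mulrS addrA (negPf nP).
  exists (ex_minn ex); case: ex_minnP => // n _ le_n k lt_kn.
  by apply/negP => /le_n; rewrite leqNgt lt_kn.
have ch : chain P (x + d) d n.
  by move=> k /minn; rewrite negbK -addrA -mulrS.
exists n; split=> //; move: stopn; rewrite /stop negb_and negbK.
case/orP=> // stopn; case: (noapp x d n); split=> //.
by case: n {minn ch} stopn => //; rewrite mulr1n xdP.
Qed.

Definition oddz (a : int) : bool := odd (absz a).

Lemma oddzD a b : oddz (a + b) = oddz a (+) oddz b.
Proof. rewrite /oddz; lia. Qed.

Lemma oddzN a : oddz (- a) = oddz a.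
Proof. by rewrite /oddz abszN. Qed.

Definition on_grid h x : bool := ~~ oddz (x.1 - h.1) && ~~ oddz (x.2 - h.2).

(** All that the folding needs to know about P.  In particular a cell that has
    neighbours in perpendicular directions is a node. *)
Definition aligned P h : Prop := forall x, x \in P ->
  (x + (1, 0) \in P -> ~~ oddz (x.2 - h.2)) /\
  (x + (0, 1) \in P -> ~~ oddz (x.1 - h.1)).

(** The invariant carried along paths of P: y is at step k of a chain that
    starts at an HV-square in the class of h, with k = 0 for that square. *)
Definition on_grid_strip P h y : Prop := exists x d n k,
  [/\ on_grid h x, consecutive_HV P x d n, (k <= n)%N & y = x + d *+ k].

(** A cell with neighbours in two perpendicular directions is an HV-square. *)
Lemma not_HV_straight P y d e : y \in P -> ~~ HV P y -> d \in dirs ->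
  e \in dirs -> y + d \in P -> y + e \in P -> e = d \/ e = - d.
Proof.
rewrite /HV => -> /=; rewrite !inE !orbF => nHV dD eD ydP yeP.
move: dD eD ydP yeP nHV => /or4P[] /eqP-> /or4P[] /eqP-> // ydP yeP;
  by rewrite ?ydP ?yeP ?orbT // ; (left + right).
Qed.

Lemma strip_interior P x d n k : consecutive_HV P x d n -> (0 < k <= n)%N ->
  [/\ x + d *+ k \in P, ~~ HV P (x + d *+ k) & x + d *+ k + d \in P].
Proof.
case=> dD HVx ch HVe; case: k => //= k lt_kn.
have Sk j : x + d + d *+ j = x + d *+ j.+1 by rewrite -addrA -mulrS.
have /andP[] := ch k lt_kn; rewrite Sk => yP nHV; split=> //.
rewrite -addrA -mulrSr; move: lt_kn; rewrite leq_eqVlt => /orP[/eqP->|lt_kn].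
  exact: HV_in.
by have /andP[] := ch k.+1 lt_kn; rewrite Sk.
Qed.

Lemma on_gridD h x d n : d \in dirs -> ~~ odd n -> on_grid h x ->
  on_grid h (x + d *+ n).
Proof.
rewrite !inE /on_grid /oddz.
by case: x h => [x1 x2] [h1 h2] /or4P[] /eqP-> /=;
  rewrite !(raddfMn fst) !(raddfMn snd) /= ?mul0rn; lia.
Qed.

Lemma on_grid_strip_HV P h x : no_appendages P -> HV P x -> on_grid h x ->
  on_grid_strip P h x.
Proof.
move=> noapp HVx gx; have /and3P[_ /hasP[d dH xdP] _] := HVx.
have dD : d \in dirs by rewrite mem_cat dH.
have [n con] := consecutive_from noapp dD HVx xdP.
by exists x, d, n, 0; split; rewrite // mulr0n addr0.
Qed.

(** From an HV-square a step enters the chain in that direction; inside a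
    chain it goes one cell forward or backward.  A step that leaves the chain
    arrives at its end, which is in the class of h because n + 1 is even. *)
Lemma on_grid_strip_adj P h y z : no_appendages P -> odd_spacing P ->
  on_grid_strip P h y -> adj y z -> z \in P -> on_grid_strip P h z.
Proof.
move=> noapp oddsp [x [d [n [k [gx con le_kn ->]]]]] yz zP.
have [e eD ez] : exists2 e, e \in dirs & z = x + d *+ k + e.
  by exists (z - (x + d *+ k)) => //; rewrite addrC subrK.
have [dD HVx _ HVe] := con.
case: k => [|k] in le_kn yz ez *.
  rewrite mulr0n addr0 in ez; rewrite ez in zP *.
  have [m con'] := consecutive_from noapp eD HVx zP.
  exists x, e, m, 1; split=> //.
  by case: m con' => // /oddsp.
have [yP nHV ydP] := strip_interior con (le_kn : (0 < k.+1 <= n)%N).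
rewrite ez in zP *.
have [->|->] := not_HV_straight yP nHV dD eD ydP zP; last first.
  exists x, d, n, k; split=> //; first exact: ltnW.
  by rewrite mulrSr addrA addrK.
rewrite -addrA -mulrSr.
move: le_kn; rewrite leq_eqVlt => /orP[/eqP ek|lt_kn]; last by exists x, d, n, k.+2.
rewrite ek; apply: on_grid_strip_HV => //; apply: on_gridD => //=.
by rewrite negbK (oddsp _ _ _ con).
Qed.


(** Consecutive entries of a cycle, the last one being followed by the first.
    Positions rather than values are used since entries may be repeated. *)
Lemma cycle_nth (T : Type) (e : rel T) (x0 : T) s i : cycle e s ->
  (i < size s)%N -> e (nth x0 s i) (nth x0 s (i.+1 %% size s)).
Proof.
case: s => // a t /= /(pathP x0) et; rewrite ltnS => le_it.
have := et i; rewrite size_rcons ltnS => /(_ le_it).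
rewrite -rcons_cons !nth_rcons /= ltnS le_it.
case: ltngtP le_it => // [lt_it|->] _; last by rewrite modnn.
by rewrite modn_small.
Qed.

(** A loop enters and leaves x through different cells, as it never turns
    straight back. *)
Lemma loop_neighbours P s x : closed_loop P s -> x \in s ->
  exists y z, [/\ y \in P, z \in P, adj y x, adj x z & y != z].
Proof.
case=> cyc sP turns xs; have s_gt0 : (0 < size s)%N by case: (s) xs.
pose n := size s; pose j := index x s.
have lt_jn : (j < n)%N by rewrite index_mem.
(* The position before j, cyclically. *)
pose i := ((j + n.-1) %% n)%N.
have lt_in : (i < n)%N by rewrite ltn_mod.
have iS : (i.+1 %% n)%N = j.
  by rewrite /i -addn1 modnDml -addnA addn1 prednK // modnDr modn_small.
have iSS : (i.+2 %% n)%N = (j.+1 %% n)%N by rewrite -iS -[in RHS]addn1 modnDml addn1.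
exists (nth 0 s i), (nth 0 s (i.+2 %% n)); split; last exact: turns.
- by apply/sP/mem_nth.
- by apply/sP/mem_nth; rewrite ltn_mod.
- by have := cycle_nth 0 cyc lt_in; rewrite iS nth_index.
- by have := cycle_nth 0 cyc lt_jn; rewrite -iSS nth_index.
Qed.

(** A cell with the largest coordinate sum has no neighbour to the right or
    above, so its two neighbours on a loop are the ones to the left and below,
    which are in perpendicular directions. *)
Lemma exists_HV P : P != fset0 ->
  {in P, forall x, exists2 s, closed_loop P s & x \in s} -> exists x, HV P x.
Proof.
move=> /fset0Pn[x0 x0P] loops.
have [x xP maxx] : exists2 x, x \in P & {in P, forall y, y.1 + y.2 <= x.1 + x.2}.
  pose f (y : P) := (val y).1 + (val y).2.
  case: (@Order.TotalTheory.arg_maxP _ _ _ [` x0P]%fset predT f) => // x _ maxx.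
  by exists (val x) => [|y yP]; [exact: valP | exact: (maxx [` yP]%fset)].
exists x; have [s loop xs] := loops x xP.
have [y [z [yP zP]]] := loop_neighbours loop xs.
have nb w : w \in P -> adj w x || adj x w ->
    w = x + (-1, 0) \/ w = x + (0, -1).
  move=> /maxx; case: w (x) => [w1 w2] [x1 x2] /= le_wx.
  rewrite /adj !inE => wx.
  have : (w1 == x1 - 1) && (w2 == x2) || (w1 == x1) && (w2 == x2 - 1).
    move: wx le_wx; rewrite !xpair_eqE /=; lia.
  by case/orP=> /andP[/eqP-> /eqP->]; [left | right]; congr pair; rewrite /= addr0.
move=> {loop xs} yx xz; have Py := nb y yP; have Pz := nb z zP.
rewrite yx in Py; rewrite xz orbT in Pz.
rewrite /HV xP; case: (Py isT) (Pz isT) yP zP => -> [] -> yP zP;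
  by rewrite ?eqxx //= yP zP ?orbT.
Qed.

Lemma exists_aligned P g : is_polyomino P -> closed_polyomino P g ->
  no_appendages P -> odd_spacing P -> exists h, aligned P h.
Proof.
move=> [P0 conn] [_ _ loops] noapp oddsp; have [h HVh] := exists_HV P0 loops.
have gh : on_grid h h by rewrite /on_grid !subrr.
exists h => y yP.
have [x [d [n [k [/andP[gx1 gx2] con le_kn ey]]]]] : on_grid_strip P h y.
  have [p [xp <- allp]] := conn h y (HV_in HVh) yP.
  have prop q x : path adj x q -> all (mem P) (x :: q) ->
      on_grid_strip P h x -> on_grid_strip P h (last x q).
    elim: q x => //= z q IH x /andP[xz zq] /and3P[_ zP allq] gsx.
    by apply: IH; rewrite /= ?zP //; exact: on_grid_strip_adj xz zP.
  by apply: prop => //; exact: on_grid_strip_HV.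
case: k => [|k] in le_kn ey.
  by rewrite mulr0n addr0 in ey; rewrite ey.
have [_ nHV ydP] := strip_interior con (le_kn : (0 < k.+1 <= n)%N).
have [dD _ _ _] := con; rewrite -ey in nHV ydP.
split=> ePy.
  have : d \in hdirs.
    have [->|->] := not_HV_straight yP nHV (isT : (1, 0) \in dirs) dD ePy ydP; by [].
  rewrite !inE ey => /orP[] /eqP-> /=; by rewrite (raddfMn snd) /= mul0rn addr0.
have : d \in vdirs.
  have [->|->] := not_HV_straight yP nHV (isT : (0, 1) \in dirs) dD ePy ydP; by [].
rewrite !inE ey => /orP[] /eqP-> /=; by rewrite (raddfMn fst) /= mul0rn addr0.
Qed.


(** * The folding *)
(** The offset of the cell that corner c faces after folding.  On a node this is
    the eighth of a turn that takes the upper right corner up; the reflections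
    of the links fix the two corners that face neighbours. *)
Definition dir (c : corner) : cell :=
  if c.1 == c.2 then (0, (-1) ^+ ~~ c.2) else ((-1) ^+ ~~ c.1, 0).

Lemma dir_opposite c : dir (opposite c) = - dir c.
Proof. by case: c => [[] []]. Qed.

Lemma oppositeK : involutive opposite.
Proof. by case=> [[] []]. Qed.

Section Geometry.
Variables (R : realType) (P : {fset cell}) (h : cell).
Hypothesis al : aligned P h.
Implicit Types (c : corner) (v : bool) (z w u : R * R) (p q : piece).

Definition oddx x := oddz (x.1 - h.1).
Definition oddy x := oddz (x.2 - h.2).

Lemma oddx_dir x c : oddx (x + dir c) = oddx x (+) (c.1 != c.2).
Proof.
by rewrite /oddx /= addrAC [LHS]oddzD; congr (_ (+) _)%B; case: c => [[] []].
Qed.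

Lemma oddy_dir x c : oddy (x + dir c) = oddy x (+) (c.1 == c.2).
Proof.
by rewrite /oddy /= addrAC [LHS]oddzD; congr (_ (+) _)%B; case: c => [[] []].
Qed.

(** Alignment read from either cell of an adjacent pair: the parity that the
    pair shares is even. *)
Lemma aligned_dir x c : x \in P -> x + dir c \in P ->
  if c.1 == c.2 then oddx x = false else oddy x = false.
Proof.
move=> xP ycP; have [al1 al2] := al xP; have := al ycP.
case: c ycP => [[] []] ycP /=.
- by move: (al2 ycP); rewrite /oddx => /negPf.
- by move: (al1 ycP); rewrite /oddy => /negPf.
- have -> : x + dir (false, true) + (1, 0) = x by rewrite -addrA; exact: addr0.
  by case=> + _ => /(_ xP) /negPf; rewrite /oddy /= addr0.
- have -> : x + dir (false, false) + (0, 1) = x by rewrite -addrA; exact: addr0.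
  by case=> _ /(_ xP) /negPf; rewrite /oddx /= addr0.
Qed.

(** The linear part of the folding on x: the identity on nodes, the reflection
    in the antidiagonal on horizontal links and in the diagonal on vertical
    ones. *)
Definition turn x u : R * R :=
  if oddx x then (- u.2, - u.1) else if oddy x then (u.2, u.1) else u.

(** The similarity that maps P to the folded figure. *)
Definition shrink z : R * R := ((z.1 + z.2) / 2, (z.2 - z.1) / 2).

Definition lay x z : R * R := shrink (center R x) + turn x (z - center R x).

Definition folded x c : bool := x + dir c \notin P.

Definition level_of x : bool := oddx x (+) oddy x.

(** The crease line through edge e meets the half t = e.2 on the side of the
    far cell and the other half on the side of the near cell; a half is left
    uncut when the corner there is folded over that line. *)
Definition grid_folding : folding R := {|
  cut := fun e t => ~~ (if t == e.2 then folded (far e) (far_corner e.2 t)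
                        else folded e.1 (near_corner e.2 t));
  crease := folded;
  place := fun p => if p.2 is Some c
    then if folded p.1 c then lay p.1 \o crease_reflection p.1 c else lay p.1
    else lay p.1;
  level := fun p =>
    level_of p.1 (+) (if p.2 is Some c then folded p.1 c else false)
|}.
Local Notation F := grid_folding.

(** * Where each piece of paper lands *)
(** The place a piece occupies after folding, named by a cell and, for a
    triangle, by the side of its diamond that the covered quarter is next to.
    It is named like a piece because the correspondence is an involution:
    unfolded corners on both sides of a common side swap their quarters. *)
Definition slot p : piece :=
  if p.2 is Some c
  then if folded p.1 c then p else (p.1 + dir c, Some (opposite c))
  else p.

Lemma slot_in p : p.1 \in P -> (slot p).1 \in P.
Proof.
by case: p => x [c|] //= xP; rewrite /slot /folded /=; case: ifPn => //; rewrite negbK.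
Qed.

Lemma slotK p : p.1 \in P -> slot (slot p) = p.
Proof.
case: p => x [c|] //= xP; rewrite {2}/slot /=; case: ifP => xc; rewrite /slot /= ?xc //.
by rewrite /folded dir_opposite addrK xP oppositeK.
Qed.

(** Triangles lie on the level opposite to the centre of the diamond they
    cover: a folded corner is flipped over its own diamond, and an unfolded one
    sticks out over a neighbour whose centre lies on the other level. *)
Lemma level_slot p : p.1 \in P ->
  level F p = level_of (slot p).1 (+) (p.2 != None).
Proof.
case: p => x [c|] //= xP; rewrite /slot /=; case: ifP => //= _.
by rewrite /level_of oddx_dir oddy_dir; case: (oddx x); case: (oddy x); case: eqP.
Qed.

(** Coordinates on the folded figure that undo the folding of the centre of y,
    so that the corners of y keep their names there. *)
Definition local y w : R * R := turn y (w - shrink (center R y)).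

Lemma pair_ext (z w : R * R) : z.1 = w.1 -> z.2 = w.2 -> z = w.
Proof. by case: z w => [? ?] [? ?] /= -> ->. Qed.

Lemma turnK y : involutive (turn y).
Proof.
by case=> a b; rewrite /turn; case: (oddx y); case: (oddy y); rewrite /= ?opprK.
Qed.

Lemma local_lay x z : local x (lay x z) = z - center R x.
Proof. by rewrite /local /lay addrAC subrr add0r turnK. Qed.

Definition unlay x w : R * R := center R x + local x w.

Lemma unlayK x : cancel (unlay x) (lay x).
Proof. by move=> w; rewrite /lay /unlay addrAC subrr add0r turnK addrC subrK. Qed.

Lemma crease_reflectionK x c : involutive (@crease_reflection R x c).
Proof.
by case: c => [[] []] z; apply: pair_ext; rewrite /= ?expr1 ?expr0; lra.
Qed.

Lemma place_surj p w : exists z, place F p z = w.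
Proof.
case: p => x [c|] /=; last by exists (unlay x w); rewrite unlayK.
case: ifP => _; last by exists (unlay x w); rewrite unlayK.
by exists (crease_reflection x c (unlay x w)); rewrite /= crease_reflectionK unlayK.
Qed.

Lemma center_dir x c :
  center R (x + dir c) = center R x + ((dir c).1%:~R, (dir c).2%:~R).
Proof. by apply: pair_ext; rewrite /= intrD; lra. Qed.

(** The paper of x and that of its neighbour differ by a reflection whose axis
    is at right angles to the crease at c; composed with the reflection in that
    crease it gives a half turn. *)
Lemma local_next x c z : x \in P -> x + dir c \in P ->
  local (x + dir c) (lay x z) = center R x - crease_reflection x c z.
Proof.
move=> xP yP; have := aligned_dir xP yP.
rewrite /local center_dir /lay /turn oddx_dir oddy_dir.
by case: c {yP} => [[] []]; case: (oddx x); case: (oddy x) => //= _;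
  apply: pair_ext; rewrite /= ?expr1 ?expr0 ?mulr1z ?mulrN1z ?mulr0z; lra.
Qed.

Lemma local_place x c z : x \in P ->
  let v := crease_reflection x c z - center R x in
  local (slot (x, Some c)).1 (place F (x, Some c) z) =
    if folded x c then v else - v.
Proof.
move=> xP /=; rewrite /slot /=; case: ifPn => [_|]; first exact: local_lay.
by rewrite negbK opprB => yP; exact: local_next.
Qed.

(** The quarter of the central diamond next to its side at corner c, closed or
    open according to r, in coordinates around the centre. *)
Definition quarter (r : rel R) c u : bool :=
  let a := (-1) ^+ (~~ c.1) * u.1 in let b := (-1) ^+ (~~ c.2) * u.2 in
  [&& r 0 a, r 0 b & r (a + b) 2^-1].

Lemma quarterN r c u : quarter r c (- u) = quarter r (opposite c) u.
Proof.
by case: c => [[] []]; rewrite /quarter /= ?expr1 ?expr0 !mul1r !mulN1r ?opprK.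
Qed.

(** The disc of the 1-norm as four linear inequalities. *)
Lemma norm1_le (a b r : R) : (`|a| + `|b| <= r) =
  [&& a + b <= r, a - b <= r, b - a <= r & - a - b <= r].
Proof.
by case: (ger0P a); case: (ger0P b) => ? ?; apply/idP/and4P => [?|[]];
  try split; lra.
Qed.

Lemma norm1_lt (a b r : R) : (`|a| + `|b| < r) =
  [&& a + b < r, a - b < r, b - a < r & - a - b < r].
Proof.
by case: (ger0P a); case: (ger0P b) => ? ?; apply/idP/and4P => [?|[]];
  try split; lra.
Qed.

(** The crease exchanges the corner triangle with the quarter of the diamond
    that has the same long side. *)
Lemma triangle_quarter x c z : piece_region (x, Some c) z <->
  quarter <=%R c (crease_reflection x c z - center R x).
Proof.
rewrite /piece_region /quarter /unit_square /dist1 /= !norm1_le.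
move: (x.1%:~R : R) (x.2%:~R : R) (z.1) (z.2) => a b z1 z2.
by case: c => [[] []]; rewrite /= ?expr1 ?expr0;
  (split=> [[[/andP[? ?] /andP[? ?]] /and4P[? ? ? ?]]|/and3P[? ? ?]];
   [apply/and3P; split | split; [split; apply/andP | apply/and4P]; split]; lra).
Qed.

Lemma open_triangle_quarter x c z : piece_interior (x, Some c) z <->
  quarter <%R c (crease_reflection x c z - center R x).
Proof.
rewrite /piece_interior /quarter /open_unit_square /dist1 /= !norm1_lt.
move: (x.1%:~R : R) (x.2%:~R : R) (z.1) (z.2) => a b z1 z2.
by case: c => [[] []]; rewrite /= ?expr1 ?expr0;
  (split=> [[[/andP[? ?] /andP[? ?]] /and4P[? ? ? ?]]|/and3P[? ? ?]];
   [apply/and3P; split | split; [split; apply/andP | apply/and4P]; split]; lra).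
Qed.

(** The part of the folded figure belonging to a slot. *)
Definition slot_region (r : rel R) p w : bool :=
  let u := local p.1 w in
  if p.2 is Some c then quarter r c u else r (`|u.1| + `|u.2|) 2^-1.

Lemma slot_region_place r p z : p.1 \in P ->
  slot_region r (slot p) (place F p z) =
  if p.2 is Some c then quarter r c (crease_reflection p.1 c z - center R p.1)
  else r (dist1 z (center R p.1)) 2^-1.
Proof.
case: p => x [c|] /= xP; last by rewrite /slot_region /= local_lay.
have := local_place c z xP; rewrite /slot /slot_region /=.
by case: (folded x c) => /= ->; rewrite // quarterN oppositeK.
Qed.

Lemma slot_region_closed p z : p.1 \in P ->
  piece_region p z <-> slot_region <=%R (slot p) (place F p z).
Proof.
move=> pP; rewrite slot_region_place //; case: p {pP} => x [c|] //.
exact: triangle_quarter.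
Qed.

Lemma slot_region_open p z : p.1 \in P ->
  piece_interior p z <-> slot_region <%R (slot p) (place F p z).
Proof.
move=> pP; rewrite slot_region_place //; case: p {pP} => x [c|] //.
exact: open_triangle_quarter.
Qed.

(** The linear parts permute coordinates up to sign. *)
Lemma local_norm1 y w :
  `|(local y w).1| + `|(local y w).2| = dist1 w (shrink (center R y)).
Proof.
rewrite /local /dist1 /turn.
by case: (oddx y); case: (oddy y); rewrite //= ?normrN addrC.
Qed.

Lemma slot_region_sub (r : rel R) p w : (forall a, r 0 a -> 0 <= a) ->
  slot_region r p w -> r (dist1 w (shrink (center R p.1))) 2^-1.
Proof.
move=> r0; rewrite -local_norm1; case: p => x [c /and3P[/r0 a0 /r0 b0]|] //=.
by rewrite -(ger0_norm a0) -(ger0_norm b0) !normrM !normrX !normrN1 !expr1n !mul1r.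
Qed.

(** * Two layers in the shape of P *)
(** [shrink] sends the maximum norm to the 1-norm. *)
Lemma shrunk_square x z :
  unit_square x z <-> dist1 (shrink z) (shrink (center R x)) <= 2^-1.
Proof.
rewrite /unit_square /dist1 norm1_le /=.
split=> [[/andP[? ?] /andP[? ?]]|/and4P[? ? ? ?]].
  by repeat (apply/andP; split); lra.
by split; apply/andP; split; lra.
Qed.

Definition unshrink w : R * R := (w.1 - w.2, w.1 + w.2).

Lemma unshrinkK : cancel unshrink shrink.
Proof. by move=> w; apply: pair_ext; rewrite /=; lra. Qed.

Lemma shrunk_cells_disjoint x y w :
  dist1 w (shrink (center R x)) < 2^-1 -> dist1 w (shrink (center R y)) < 2^-1 ->
  x = y.
Proof.
case: x y => [x1 x2] [y1 y2].
rewrite /dist1 !norm1_lt /= => /and4P[? ? ? ?] /and4P[? ? ? ?].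
have close (a b : int) : a%:~R - b%:~R < 1 :> R -> b%:~R - a%:~R < 1 :> R -> a = b.
  by rewrite -!intrB -[1]/(1%:~R) !ltr_int; lia.
by congr pair; apply: close; lra.
Qed.

Lemma folded_figureE w : folded_figure P F w <->
  exists2 x, x \in P & dist1 w (shrink (center R x)) <= 2^-1.
Proof.
split=> [[p [z [pP pz ->]]]|[x xP wx]].
  exists (slot p).1; first exact: slot_in.
  by apply: (@slot_region_sub <=%R) => //; apply/slot_region_closed.
have [z zw] := place_surj (x, None) w; exists (x, None), z; split=> //.
by apply/(slot_region_closed (p := (x, None))); rewrite ?zw // /slot_region local_norm1.
Qed.

Lemma grid_same_shape : same_shape P F.
Proof.
exists shrink => [z w|w].
  rewrite /edist -sqrtrV ?ler0n // -sqrtrM ?invr_ge0 ?ler0n //.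
  by congr Num.sqrt; rewrite /=; field.
rewrite folded_figureE; split=> [[x xP wx]|[z [x xP xz] ->]].
  exists (unshrink w); last by rewrite unshrinkK.
  by exists x => //; apply/shrunk_square; rewrite unshrinkK.
by exists x => //; apply/shrunk_square.
Qed.

Lemma quarter_inj c c' u : quarter <%R c u -> quarter <%R c' u -> c = c'.
Proof.
move=> /and3P[+ + _] /and3P[+ + _].
by case: c c' => [[] []] [[] []] //=; rewrite ?expr1 ?expr0 => ? ? ? ?; exfalso; lra.
Qed.

(** A level shows over each diamond either its centre or the four quarters.
    Covering holds since [slot] is onto, disjointness since it is injective. *)
Lemma grid_two_layers : two_layers P F.
Proof.
move=> b; split=> [w /folded_figureE[x xP wx]|p q z z'].
  have [q [qP qw qb]] : exists q, [/\ q.1 \in P, slot_region <=%R q w &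
      level_of q.1 (+) (q.2 != None) = b].
    have [lx|lx] := eqVneq (level_of x) b.
      by exists (x, None); rewrite /slot_region local_norm1 addbF.
    (* The signs of the coordinates of w around x tell the quarter. *)
    pose u := local x w; exists (x, Some (0 <= u.1, 0 <= u.2)); split=> //=.
      rewrite -local_norm1 -/u norm1_le in wx; case/and4P: wx => ? ? ? ?.
      rewrite /slot_region /quarter /= -/u.
      by case: (leP 0 u.1); case: (leP 0 u.2); rewrite /= ?expr1 ?expr0 => ? ?;
        apply/and3P; split; lra.
    by move: lx; case: b; case: (level_of x).
  (* The piece that lands on slot q is slot q itself, by involution. *)
  have [z zw] := place_surj (slot q) w.
  have sP := slot_in qP; exists (slot q), z; split=> //.
    split=> //; rewrite level_slot // slotK // -qb.
    case: q {qP qw qb zw sP} => [y [c|]] //=.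
    by rewrite /slot /=; case: ifP.
  by apply/slot_region_closed; rewrite // zw slotK.
move=> [pP pb] [qP qb] /(slot_region_open _ pP) + /(slot_region_open _ qP) + pq.
rewrite -pq {pq}; move: (place F p z) => w pw qw.
rewrite -(slotK pP) -(slotK qP); congr slot.
have eqx := shrunk_cells_disjoint (slot_region_sub (@ltW _ _ _) pw)
                                  (slot_region_sub (@ltW _ _ _) qw).
have slot2 y c : (slot (y, Some c)).2 != None by rewrite /slot /=; case: ifP.
have : (p.2 != None) = (q.2 != None).
  by apply: (@addbI (level_of (slot p).1)); rewrite {2}eqx -!level_slot // pb.
(* Now p and q are both centres or both triangles; in the latter case the
   quarters tell them apart. *)
move: eqx pw qw; case: p q {pP pb qP qb} => x [c|] [y [d|]] //=; last first.
  by rewrite /slot /= => ->.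
move: (slot2 x c) (slot2 y d).
case: (slot (x, Some c)) (slot (y, Some d)) => x' [c'|] [y' [d'|]] // _ _ /= -> cw dw _.
by rewrite (quarter_inj cw dw).
Qed.

Lemma lay_isometry x : Defs.isometry (lay x).
Proof.
move=> z w; rewrite /edist /lay /turn; congr Num.sqrt.
by case: (oddx x); case: (oddy x); rewrite /=; ring.
Qed.

Lemma crease_reflection_isometry x c : Defs.isometry (@crease_reflection R x c).
Proof.
by move=> z w; rewrite /edist; congr Num.sqrt; case: c => [[] []];
  rewrite /= ?expr1 ?expr0; field.
Qed.

Lemma place_isometry p : Defs.isometry (place F p).
Proof.
case: p => x [c|] /=; last exact: lay_isometry.
case: ifP => _; last exact: lay_isometry.
by move=> z w /=; rewrite lay_isometry crease_reflection_isometry.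
Qed.

(** * Creases and cuts *)
Lemma edgesP e : e \in edges P -> e.1 \in P /\ far e \in P.
Proof.
rewrite mem_filter => /andP[fP /allpairsP[[x v] /= [xP _ ee]]].
by rewrite ee in fP *.
Qed.

Lemma far_dir x v : far (x, v) = x + dir (near_corner v v).
Proof. by case: v. Qed.

Lemma dir_far_corner v : dir (far_corner v (~~ v)) = - dir (near_corner v v).
Proof. by case: v. Qed.

Lemma unfolded_near x v : far (x, v) \in P -> folded x (near_corner v v) = false.
Proof. by rewrite far_dir /folded => ->. Qed.

Lemma unfolded_far x v : x \in P ->
  folded (far (x, v)) (far_corner v (~~ v)) = false.
Proof. by rewrite /folded dir_far_corner far_dir addrK => ->. Qed.

(** The crease line at the near end of an edge runs straight on to the far
    one. *)
Lemma shared_crease x v :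
  @crease_reflection R (far (x, v)) (far_corner v v) =1
  crease_reflection x (near_corner v (~~ v)).
Proof.
move=> z; rewrite far_dir /crease_reflection center_dir.
by case: v; apply: pair_ext; rewrite /= ?expr1 ?expr0 ?mulr1z ?mulr0z; lra.
Qed.

(** Crossing an edge amounts to folding along the crease line through its
    midpoint: this makes uncut halves match and cut ends meet. *)
Lemma lay_far x v : x \in P -> far (x, v) \in P ->
  lay (far (x, v)) =1 lay x \o crease_reflection x (near_corner v (~~ v)).
Proof.
rewrite far_dir => xP yP z; have := aligned_dir xP yP.
rewrite /lay /turn /comp /crease_reflection center_dir oddx_dir oddy_dir.
by case: v {yP}; case: (oddx x); case: (oddy x) => //= _; apply: pair_ext;
  rewrite /= ?expr1 ?expr0 ?mulr1z ?mulr0z; lra.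
Qed.

Lemma level_of_far x v : level_of (far (x, v)) = ~~ level_of x.
Proof.
rewrite far_dir /level_of oddx_dir oddy_dir.
by case: v; case: (oddx x); case: (oddy x).
Qed.

Lemma grid_uncut_edges_flat : uncut_edges_flat P F.
Proof.
move=> [x v] t /edgesP[/= xP yP]; rewrite negbK.
have [->|tv] := eqVneq t v => [fold_y|fold_x].
  rewrite unfolded_near // fold_y level_of_far addbF addbT negbK.
  by split=> // z /=; rewrite lay_far //= shared_crease crease_reflectionK.
have et : t = ~~ v by case: t v tv {xP yP fold_x} => [] [].
rewrite et in fold_x *; rewrite fold_x unfolded_far // level_of_far addbF addbT.
by split=> // z /=; rewrite lay_far.
Qed.

(** A full cut would need a cell in the perpendicular direction at both ends
    of the edge; the offset from h that changes along the edge would then be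
    even at both ends. *)
Lemma grid_not_fully_cut e : e \in edges P -> ~~ fully_cut F e.
Proof.
case: e => x v /edgesP[/= xP yP]; apply/negP.
have [cut_x cut_y] : cut F (x, v) (~~ v) = (x + dir (near_corner v (~~ v)) \in P)
    /\ cut F (x, v) v = (far (x, v) + dir (far_corner v v) \in P).
  by split=> /=; rewrite ?eqxx /folded; [case: (v) | ]; rewrite /= negbK.
move=> full; have /andP[] : cut F (x, v) (~~ v) && cut F (x, v) v.
  by move: full; rewrite /fully_cut; case: (v); rewrite // andbC.
rewrite cut_x cut_y => /(aligned_dir xP) + /(aligned_dir yP).
by rewrite far_dir oddx_dir oddy_dir; case: (v) => /= ->.
Qed.

Lemma adj_attached x y : x \in P -> y \in P -> adj x y -> attached F x y.
Proof.
move=> xP yP; have uncut (e : edge) : e.1 \in P -> far e \in P -> ~~ fully_cut F e.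
  case: e => x' v x'P farP; apply: grid_not_fully_cut; rewrite mem_filter farP andTb.
  by apply/allpairsP; exists (x', v); split=> //; case: (v).
have forward x' v : x' \in P -> far (x', v) \in P ->
    (far (x', v) == far (x', v)) && ~~ fully_cut F (x', v).
  by move=> x'P farP; rewrite eqxx uncut.
have back (d : cell) : y - x = - d -> x = y + d.
  by move/(canRL (subrK x)) ->; rewrite addrAC addNr add0r.
rewrite /adj /dirs mem_cat !inE /attached /= orbF.
case/orP => /orP[] /eqP yx.
- have ey : y = far (x, false) by rewrite (canRL (subrK x) yx) addrC.
  by rewrite ey in yP *; rewrite forward.
- have ex : x = far (y, false) by apply: back.
  by rewrite ex in xP *; rewrite forward ?orbT.
- have ey : y = far (x, true) by rewrite (canRL (subrK x) yx) addrC.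
  by rewrite ey in yP *; rewrite forward ?orbT.
- have ex : x = far (y, true) by apply: back.
  by rewrite ex in xP *; rewrite forward ?orbT.
Qed.

Lemma grid_admissible_cuts g :
  {in P &, forall x y, linked adj (mem P) x y} -> admissible_cuts P g F.
Proof.
move=> conn; split=> [|x y xP yP].
  rewrite (eq_in_count (a2 := pred0)) ?count_pred0 //.
  by move=> e /grid_not_fully_cut/negPf.
have [p [xp <- allp]] := conn x y xP yP; exists p; split=> //.
elim: p x xp allp {xP yP} => //= y' p IH x /andP[xy' y'p] /and3P[xP y'P allp].
by rewrite adj_attached //= IH //= y'P.
Qed.

(** One of the two cells that the crease line at c might enter is x + dir c,
    which is missing when c is folded. *)
Lemma grid_admissible_creases : admissible_creases P F.
Proof.
by move=> x [[] []] _; rewrite /= /folded /extends_to => /negPf /= ->; rewrite ?andbF.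
Qed.

Lemma grid_corners_folded : corners_folded P F.
Proof. by move=> x c _ /=; case: (folded x c). Qed.

(** The midpoint of an edge lies on the crease line through it. *)
Lemma grid_cut_ends_meet : cut_ends_meet P F.
Proof.
move=> [x v] /edgesP[/= xP yP] _; split=> /=.
  rewrite lay_far //=; congr lay.
  by case: v {yP}; apply: pair_ext; rewrite /= ?expr1 ?expr0; lra.
have lay_center y : lay y (center R y) = shrink (center R y).
  rewrite /lay subrr (_ : turn y 0 = 0) ?addr0 // /turn.
  by case: (oddx y); case: (oddy y); apply: pair_ext; rewrite /= ?oppr0.
rewrite !lay_center far_dir center_dir -sqrtrV ?ler0n // /edist; congr Num.sqrt.
by case: v {yP}; rewrite /= ?mulr1z ?mulr0z; field.
Qed.

Lemma grid_folds g : {in P &, forall x y, linked adj (mem P) x y} ->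
  folds_to_two_levels R P g.
Proof.
move=> conn; exists F; split=> [p _|||| ].
- exact: place_isometry.
- by split; [exact: grid_admissible_cuts | exact: grid_admissible_creases].
- by split; [exact: grid_corners_folded | exact: grid_uncut_edges_flat].
- exact: grid_two_layers.
- by split; [exact: grid_same_shape | exact: grid_cut_ends_meet].
Qed.

End Geometry.

Theorem theorem2p3 (R : realType) (P : {fset cell}) (g : nat) :
  is_polyomino P ->
  well_formed P ->
  closed_polyomino P g ->
  no_appendages P ->
  odd_spacing P ->
  folds_to_two_levels R P g.
Proof.
move=> polyP _ closedP noapp oddsp.
have [h al] := exists_aligned polyP closedP noapp oddsp.
by have [_ conn] := polyP; exact: grid_folds al g conn.
Qed.
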